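(* Let $n$ be a positive integer divisible by $4$ and let $d=n/2$. The strength of the inequality $$\sum_{i=1}^d f_i t_i\ \ge\ \frac{n^2}{2}-n-2,\qquad f_i=\begin{cases} d-2+i, & i \text{ odd}\\ d-2+(d-i), & i\text{ even,}\end{cases}$$ (the circlet inequality in tight triangular form) relative to the subtour polytope $SP(n)$ is $$\frac{n^2-2n-4}{n^2-3n}\ \le\ \frac{11}{10}.$$ It is equal to $\frac{11}{10}$ when $n=8$.
   Context: $K_n=([n],E)$ is the complete undirected graph on $[n]=\{1,\dots,n\}$. The length of an edge $\{i,j\}$ is $\ell_{i,j}=\min\{|i-j|,\,n-|i-j|\}$. For $x\in\mathbb{R}^{E}$ and $1\le i\le d$, $t_i=\sum_{\{s,t\}\in E:\ \ell_{s,t}=i}x_{s,t}$. The subtour polytope $SP(n)$ is the set of $x\in\mathbb{R}^E$ with $\sum_{e\in\delta(v)}x_e=2$ for all $v\in[n]$, $\sum_{e\in\delta(S)}x_e\ge 2$ for all $S\subset[n]$ with $S\ne\emptyset$, $S\neq[n]$, and $0\le x_e\le 1$ for all $e\in E$, where $\delta(S)$ is the set of edges with exactly one endpoint in $S$ and $\delta(v)=\delta(\{v\})$. The strength (following Goemans) of an inequality $ax\ge b$ given in tight triangular form, relative to $SP(n)$, is the ratio $\dfrac{b}{\min\{ax: x\in SP(n)\}}$. An inequality $ax\geq b$ is in tight triangular form if $a_{ij}+a_{jk}\ge a_{ik}$ for all distinct triples $i,j,k$, and for every vertex $j$ there exist distinct $i,k\in[n]\setminus\{j\}$ with $a_{ij}+a_{jk}=a_{ik}$.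 *)

(* Defs.v *)
From HB Require Import structures.
From mathcomp Require Import all_boot all_order all_algebra.
From mathcomp Require Import reals.
Set Implicit Arguments. Unset Strict Implicit. Unset Printing Implicit Defensive.
Import Order.TTheory GRing.Theory Num.Theory.
Local Open Scope ring_scope.

(* The vertex set {1, ..., n} is 'I_n, i.e. shifted to {0, ..., n-1}; only
   differences of vertices matter. *)

Definition edge (n : nat) : finType := {e : {set 'I_n} | #|e| == 2}.

Lemma edge_subproof (n : nat) (i j : 'I_n) : i != j -> #|[set i; j]| == 2.
Proof. by rewrite cards2 => ->. Qed.

Definition Edge (n : nat) (i j : 'I_n) (ij : i != j) : edge n :=
  exist _ [set i; j] (edge_subproof ij).

Definition circ_dist (n : nat) (i j : 'I_n) : nat :=
  let k := (maxn i j - minn i j)%N in minn k (n - k).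

(* The length of the edge {i, j}: since circ_dist is symmetric and vanishes on
   the diagonal, the maximum over the endpoints is circ_dist i j, see
   edge_lenE. *)
Definition edge_len (n : nat) (e : edge n) : nat :=
  \max_(i in val e) \max_(j in val e) circ_dist i j.

Lemma edge_lenE (n : nat) (i j : 'I_n) (ij : i != j) :
  edge_len (Edge ij) = circ_dist i j.
Proof.
have dC k l : @circ_dist n k l = circ_dist l k.
  by rewrite /circ_dist (maxnC k) (minnC k).
have d0 k : @circ_dist n k k = 0%N.
  by rewrite /circ_dist maxnn minnn subnn min0n.
have ijn : i \notin [set j] by rewrite inE.
rewrite /edge_len /= big_setU1 //= big_set1 !big_setU1 //= !big_set1.
by rewrite !d0 max0n maxn0 (dC j i) maxnn.
Qed.

Section Subtour.
Variables (R : realType) (n : nat).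
Implicit Types (a x : edge n -> R) (S : {set 'I_n}).

Definition cut S : {set edge n} := [set e | #|val e :&: S| == 1%N].

Definition subtour_polytope x : Prop :=
  [/\ forall v : 'I_n, \sum_(e in cut [set v]) x e = 2,
      forall S, S != set0 -> S != [set: 'I_n] -> 2 <= \sum_(e in cut S) x e
    & forall e, 0 <= x e <= 1].

Definition len_sum (i : nat) x : R := \sum_(e | edge_len e == i) x e.

Definition dot a x : R := \sum_e a e * x e.

Definition tight_triangular a : Prop :=
  (forall (i j k : 'I_n) (ij : i != j) (jk : j != k) (ik : i != k),
     a (Edge ik) <= a (Edge ij) + a (Edge jk)) /\
  (forall j : 'I_n, exists (i k : 'I_n) (ij : i != j) (jk : j != k)
                           (ik : i != k),
     a (Edge ij) + a (Edge jk) = a (Edge ik)).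

Definition is_min_subtour a (m : R) : Prop :=
  (exists2 x, subtour_polytope x & dot a x = m) /\
  (forall x, subtour_polytope x -> m <= dot a x).

(* [m != 0] makes the ratio meaningful, as [b / 0 = 0] in MathComp. *)
Definition has_strength a (b s : R) : Prop :=
  exists m : R, [/\ is_min_subtour a m, m != 0 & s = b / m].

Definition circlet_f (i : nat) : R :=
  let d := n./2 in
  if odd i then d%:R - 2 + i%:R else d%:R - 2 + (d%:R - i%:R).

Definition circlet_coef (e : edge n) : R := circlet_f (edge_len e).

Definition circlet_rhs : R := n%:R ^+ 2 / 2 - n%:R - 2.

End Subtour.

Arguments circlet_f R n i : clear implicits.
Arguments circlet_coef R n e : clear implicits.
Arguments circlet_rhs R n : clear implicits.

(* Main.v *)
Require Import Defs.
From HB Require Import structures.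
From mathcomp Require Import all_boot all_order all_algebra.
From mathcomp Require Import reals.
From mathcomp Require Import zify ring lra.
Set Implicit Arguments. Unset Strict Implicit. Unset Printing Implicit Defensive.
Import Order.TTheory GRing.Theory Num.Theory.
Local Open Scope ring_scope.

(** Write [d] for [n / 2], which is even. The whole argument rests on the costs
    [f] of the lengths [1 .. d]: they lie between [d - 1] and [2 d - 3], except
    for the cost [d - 2] of the diameters, the edges of length [d].

    Triangle inequality: a triangle contains at most one diameter, so two of
    its sides cost at least [(d - 2) + (d - 1) = 2 d - 3], the largest cost. It
    is tight at every vertex [j], for the triangle [j + d], [j], [j + 1], whose
    sides have lengths [d], [1], [d - 1].

    Minimum over the subtour polytope: it is [d (2 d - 3) = (n^2 - 3 n) / 2].
    At each vertex the degree constraint spends weight [2] at cost at least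
    [d - 1] per unit, with a discount of [1] per unit of weight on the unique
    diameter there, whose weight is at most [1]. So the edges at a vertex cost
    at least [2 (d - 1) - 1 = 2 d - 3] ([circlet_lower_bound]); summing over the
    vertices counts each edge twice. Equality holds for the point with weight
    [1] on the diameters and [1/2] on the sides, the edges of length [1]
    ([circlet_half_cycle_point]).

    That point satisfies the cut constraints ([half_cycle_point_cut]): walking
    around the circle, one leaves and enters a proper nonempty [S] at least once
    each, so at least two sides cross its boundary, with total weight [1]. If a
    diameter crosses too, this makes [2]. If none does, [S] is invariant under
    the half turn, so the crossing sides come in antipodal pairs, and there are
    at least four of them.

    The strength is then an explicit fraction, and the bound [11/10] amounts to
    [(n - 5) (n - 8) >= 0], which holds for [n = 4] and for [n >= 8]. *)

(** * Edges and cuts of the complete graph *)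

Lemma edgeP (n : nat) (e : edge n) :
  exists (i j : 'I_n) (ij : i != j), e = Edge ij.
Proof.
have [i [j [ij eij]]] := cards2P _ (svalP e).
by exists i, j, ij; apply: val_inj.
Qed.

Lemma Edge_in_cut (n : nat) (S : {set 'I_n}) (i j : 'I_n) (ij : i != j) :
  (Edge ij \in cut S) = ((i \in S) != (j \in S)).
Proof.
rewrite inE /= setIUl.
have inter1 k : [set k] :&: S = if k \in S then [set k] else set0.
  apply/setP => l.
  by case kS: (k \in S); rewrite !inE; case: eqVneq => // ->; rewrite kS.
rewrite !inter1; case: (i \in S); case: (j \in S).
- by rewrite cards2 ij.
- by rewrite setU0 cards1.
- by rewrite set0U cards1.
- by rewrite setU0 cards0.
Qed.

Lemma in_cut1 (n : nat) (v : 'I_n) (e : edge n) :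
  (e \in cut [set v]) = (v \in val e).
Proof.
have [i [j [ij ->]]] := edgeP e.
rewrite Edge_in_cut !inE /= (eq_sym v i) (eq_sym v j).
case: (eqVneq i v) ij => [->|_ _]; last by case: (j == v).
by rewrite eq_sym => /negPf->.
Qed.

Lemma handshake (R : realType) (n : nat) (F : edge n -> R) :
  \sum_(v : 'I_n) \sum_(e in cut [set v]) F e = 2 * \sum_e F e.
Proof.
rewrite (exchange_big_dep predT) //= mulr_sumr; apply: eq_bigr => e _.
under eq_bigl => v do rewrite in_cut1.
by rewrite sumr_const (eqP (svalP e)) mulr_natl.
Qed.

(** Names the second endpoint, so that sums over the edges at [v] can be
    computed as sums over vertices. *)
Lemma star_edgeP (n : nat) (v : 'I_n) (e : edge n) :
  v \in val e -> exists (w : 'I_n) (vw : v != w), e = Edge vw.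
Proof.
have [i [j [ij ->]]] := edgeP e; rewrite !inE => /orP[] /eqP vE; subst v.
  by exists j, ij.
have ji : j != i by rewrite eq_sym.
by exists i, ji; apply: val_inj; rewrite /= setUC.
Qed.

(** The edges at [v] correspond to the other vertices; this turns the sum over a
    star into arithmetic with distances. *)
Lemma star_sum (R : realType) (n : nat) (h : nat -> R) (v : 'I_n) :
  \sum_(e in cut [set v]) h (edge_len e) =
  \sum_(w | v != w) h (circ_dist v w).
Proof.
(* Joining to v is partial, being undefined at w = v; its inverse takes the
   other endpoint. The default v returned by other makes every edge that
   avoids v fail the test of the reindexing. *)
pose toEdge (w : 'I_n) : option (edge n) := insub [set v; w].
pose other (e : edge n) := odflt v [pick w in val e :\ v].
have toEdgeE (w : 'I_n) (vw : v != w) : toEdge w = Some (Edge vw).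
  by rewrite /toEdge insubT ?edge_subproof // => ?; congr Some; apply: val_inj.
have otherE (w : 'I_n) (vw : v != w) : other (Edge vw) = w.
  rewrite /other; case: pickP => [u|/(_ w)] /=.
    by rewrite !inE => /andP[/negPf->] /eqP.
  by rewrite !inE eqxx orbT andbT eq_sym vw.
rewrite [RHS](reindex_omap other toEdge) => [|w vw]; last first.
  by rewrite (toEdgeE _ vw) /= otherE.
apply: eq_big => [e|e]; rewrite in_cut1.
  apply/idP/andP => [/star_edgeP[w [vw ->]]|[vw /eqP]].
    by rewrite otherE (toEdgeE _ vw).
  by rewrite (toEdgeE _ vw) => -[<-]; rewrite !inE eqxx.
by case/star_edgeP => w [vw ->]; rewrite otherE edge_lenE.
Qed.

(** * Circular distances *)

Section Circle.
Variables (n : nat) (n_gt0 : (0 < n)%N).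

Definition rot (k : nat) (v : 'I_n) : 'I_n := Ordinal (ltn_pmod (v + k) n_gt0).

Lemma ord_eqE (v w : 'I_n) : (v == w) = (v == w :> nat).
Proof. by []. Qed.

(** Trades the remainder for a case split, which linear arithmetic can handle
    with a variable [n]. *)
Lemma rotE k v : (k < n)%N ->
  rot k v = (if v + k < n then v + k else v + k - n)%N :> nat.
Proof.
move=> kn /=; case: ltnP => vk; first by rewrite modn_small.
have vn := ltn_ord v.
by rewrite -{1}(subnK vk) modnDr modn_small //; lia.
Qed.

Hypothesis n_div4 : (4 %| n)%N.

Lemma circ_dist_bounds (v w : 'I_n) : v != w -> (0 < circ_dist v w <= n./2)%N.
Proof.
have vn := ltn_ord v; have wn := ltn_ord w.
rewrite ord_eqE /circ_dist /=; lia.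
Qed.

Lemma circ_dist_half (v w : 'I_n) : (circ_dist v w == n./2) = (w == rot n./2 v).
Proof.
have vn := ltn_ord v; have wn := ltn_ord w.
rewrite ord_eqE rotE; last lia.
rewrite /circ_dist; case: ltnP => ?; lia.
Qed.

Lemma circ_dist1 (v w : 'I_n) :
  (circ_dist v w == 1%N) = (w == rot 1 v) || (w == rot n.-1 v).
Proof.
have vn := ltn_ord v; have wn := ltn_ord w.
rewrite !ord_eqE !rotE; try lia.
rewrite /circ_dist; do 2!case: ltnP => ?; lia.
Qed.

Lemma rot0 v : rot 0 v = v.
Proof. by apply: val_inj; rewrite /= addn0 modn_small. Qed.

Lemma rotD k l v : rot k (rot l v) = rot (l + k) v.
Proof. by apply: val_inj; rewrite /= modnDml addnA. Qed.

Lemma rot_eq k l v : (k < n)%N -> (l < n)%N -> (rot k v == rot l v) = (k == l).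
Proof.
move=> kn ln; have vn := ltn_ord v.
rewrite ord_eqE !rotE //; do 2!case: ltnP => ?; lia.
Qed.

Lemma rot_transitive (v w : 'I_n) : exists k, w = rot k v.
Proof.
have [vn wn] := (ltn_ord v, ltn_ord w).
exists (w + n - v)%N; apply: val_inj => /=.
by rewrite addnC subnK ?modnDr ?modn_small //; lia.
Qed.

Lemma rot_halfK v : rot n./2 (rot n./2 v) = v.
Proof.
rewrite rotD; have -> : (n./2 + n./2 = n)%N by lia.
by apply: val_inj; rewrite /= modnDr modn_small.
Qed.

(** A set without such a [v] is closed under the unit rotation, whose iterates
    act transitively: it would be empty or full. *)
Lemma exists_boundary (S : {set 'I_n}) :
  S != set0 -> S != [set: 'I_n] -> exists2 v, v \in S & rot 1 v \notin S.
Proof.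
move=> /set0Pn[v0 v0S] SnT; apply/exists_inP; apply: contraNT SnT.
rewrite negb_exists_in => /forall_inP Scl; apply/eqP/setP => w.
rewrite inE; have [k ->] := rot_transitive v0 w.
elim: k => [|k IHk]; first by rewrite rot0.
by rewrite -addn1 -rotD; have := Scl _ IHk; rewrite negbK.
Qed.

Lemma neq_rot k v : (0 < k < n)%N -> v != rot k v.
Proof. by move=> kn; rewrite -{1}(rot0 v) rot_eq //; lia. Qed.

Lemma side_proof v : v != rot 1 v.
Proof. by apply: neq_rot; lia. Qed.

Definition side v : edge n := Edge (side_proof v).

Lemma diameter_proof v : v != rot n./2 v.
Proof. by apply: neq_rot; lia. Qed.

Definition diameter v : edge n := Edge (diameter_proof v).

Lemma edge_len_side v : edge_len (side v) = 1%N.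
Proof. by rewrite edge_lenE; apply/eqP; rewrite circ_dist1 eqxx. Qed.

Lemma edge_len_diameter v : edge_len (diameter v) = n./2.
Proof. by rewrite edge_lenE; apply/eqP; rewrite circ_dist_half. Qed.

Lemma edge_len_bounds (e : edge n) : (0 < edge_len e <= n./2)%N.
Proof. by have [i [j [ij ->]]] := edgeP e; rewrite edge_lenE circ_dist_bounds. Qed.

(** If [v] and [w] were the two ends of one side, each would be the successor of
    the other, and going two steps would be the identity; but [n > 2]. *)
Lemma side_inj : injective side.
Proof.
move=> v w /(congr1 val)/= eqvw; apply/eqP/negPn/negP => neq_vw.
have /set2P[/eqP|vw] : v \in [set w; rot 1 w] by rewrite -eqvw set21.
  by rewrite (negPf neq_vw).
have /set2P[/eqP|wv] : w \in [set v; rot 1 v] by rewrite eqvw set21.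
  by rewrite eq_sym (negPf neq_vw).
have /eqP : v = rot 2 v by rewrite {1}vw wv rotD.
by apply/negP/neq_rot; lia.
Qed.

(** Each vertex meets one diameter and two sides, the latter leading to its
    rotations by [1] and by [n - 1]. *)
Lemma star_sum_sides_diameter (R : realType) (h : nat -> R) (v : 'I_n) :
  (forall k, k != 1%N -> k != n./2 -> h k = 0) ->
  \sum_(e in cut [set v]) h (edge_len e) = h n./2 + 2 * h 1%N.
Proof.
move=> h0; rewrite star_sum.
rewrite (bigD1 (rot n./2 v)) ?diameter_proof //=.
rewrite (bigD1 (rot 1 v)) /=; last by rewrite side_proof rot_eq; lia.
rewrite (bigD1 (rot n.-1 v)) /=; last first.
  by rewrite neq_rot ?rot_eq; lia.
rewrite big1 ?addr0 => [|w]; last first.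
  move=> /andP[/andP[/andP[_ wd] w1] wn]; apply: h0.
    by rewrite circ_dist1 negb_or w1.
  by rewrite circ_dist_half.
have /eqP-> : circ_dist v (rot n./2 v) == n./2 by rewrite circ_dist_half.
have /eqP-> : circ_dist v (rot 1 v) == 1%N by rewrite circ_dist1 eqxx.
have /eqP-> : circ_dist v (rot n.-1 v) == 1%N by rewrite circ_dist1 eqxx orbT.
by rewrite mulr2n mulrDl mul1r.
Qed.

(** * The optimal point *)

Section Optimum.
Variable R : realType.

(** The sum of the perfect matching of the diameters and of half the
    Hamiltonian cycle of the sides. *)
Definition half_cycle_point (e : edge n) : R :=
  (edge_len e == n./2)%:R + (edge_len e == 1%N)%:R / 2.

Lemma half_cycle_point_ge0 e : 0 <= half_cycle_point e.
Proof. by rewrite addr_ge0 ?divr_ge0 ?ler0n. Qed.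

(** A lower bound on the number of sides crossing [S], from any set of places
    where the cycle crosses; distinct places give distinct sides. *)
Lemma sum_cut_sides (S V : {set 'I_n}) :
  {in V, forall v, (v \in S) != (rot 1 v \in S)} ->
  #|V|%:R <= \sum_(e in cut S) (edge_len e == 1%N)%:R :> R.
Proof.
move=> Vb.
rewrite -(card_imset _ side_inj) -sum1_card natr_sum.
rewrite [leRHS](bigID [in side @: V]) /= -[leLHS]addr0.
apply: lerD; last by apply: sumr_ge0 => e _; apply: ler0n.
rewrite le_eqVlt; apply/predU1P; left; apply: eq_big => e.
  apply/idP/andP => [eV|[]//]; split=> //.
  by case/imsetP: eV => v vV ->; rewrite Edge_in_cut Vb.
by case/imsetP => v _ ->; rewrite edge_len_side.
Qed.

(** Either a diameter and two sides cross the boundary of [S], or [S] is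
    invariant under the half turn and four sides cross it. *)
Lemma half_cycle_point_cut (S : {set 'I_n}) : S != set0 -> S != [set: 'I_n] ->
  2 <= \sum_(e in cut S) half_cycle_point e.
Proof.
move=> S0 ST.
have [v vS v1S] := exists_boundary S0 ST.
have [w wS w1S] : exists2 w, w \notin S & rot 1 w \in S.
  have [||w] := @exists_boundary (~: S).
  - by rewrite -setCT (inj_eq (@setC_inj _)).
  - by rewrite -setC0 (inj_eq (@setC_inj _)).
  by rewrite !inE negbK; exists w.
have vw : v != w by apply: contraNneq wS => <-.
rewrite big_split /= -mulr_suml.
have [/exists_inP[u uS udS] | Scl] :=
    boolP [exists u in S, rot n./2 u \notin S].
- have sides := @sum_cut_sides S [set v; w].
  have {sides} : 2 <= \sum_(e in cut S) (edge_len e == 1%N)%:R :> R.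
    move: sides; rewrite cards2 vw; apply=> z /set2P[]->.
      by rewrite vS (negPf v1S).
    by rewrite w1S (negPf wS).
  have : 1 <= \sum_(e in cut S) (edge_len e == n./2)%:R :> R.
    rewrite (bigD1 (diameter u)) /=; last first.
      by rewrite Edge_in_cut uS (negPf udS).
    by rewrite edge_len_diameter eqxx lerDl sumr_ge0 // => e _; apply: ler0n.
  lra.
have Sd z : (rot n./2 z \in S) = (z \in S).
  move: Scl; rewrite negb_exists_in => /forall_inP Scl.
  apply/idP/idP => [/Scl|/Scl]; rewrite negbK //.
  by rewrite rot_halfK.
have rot1d z : rot 1 (rot n./2 z) = rot n./2 (rot 1 z).
  by rewrite !rotD addnC.
(* Exits start in S, entrances start outside: the two pairs are disjoint. *)
have card4 : #|[set v; rot n./2 v] :|: [set w; rot n./2 w]| = 4%N.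
  rewrite cardsU !cards2 !diameter_proof; set I := _ :&: _.
  have -> : I = set0; last by rewrite cards0.
  apply/setP => z; rewrite !inE; apply/negP => /andP[zv zw].
  have zS : z \in S by case/orP: zv => /eqP->; rewrite ?Sd.
  by case/orP: zw zS => /eqP->; rewrite ?Sd (negPf wS).
have := @sum_cut_sides S ([set v; rot n./2 v] :|: [set w; rot n./2 w]).
rewrite card4 => sides.
have {sides} : 4 <= \sum_(e in cut S) (edge_len e == 1%N)%:R :> R.
  apply: sides => z; rewrite !inE -orbA => /or4P[] /eqP->;
    by rewrite ?rot1d ?Sd ?vS ?w1S ?(negPf v1S) ?(negPf wS).
have : 0 <= \sum_(e in cut S) (edge_len e == n./2)%:R :> R.
  by rewrite sumr_ge0 // => e _; apply: ler0n.
lra.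
Qed.

Lemma half_neq1 : (n./2 == 1)%N = false.
Proof. by lia. Qed.

Lemma half_cycle_point_subtour : subtour_polytope half_cycle_point.
Proof.
split=> [v||e]; last 1 first.
- rewrite half_cycle_point_ge0 /half_cycle_point /=.
  case: (eqVneq (edge_len e) n./2) => [->|_].
    by rewrite half_neq1 /=; lra.
  by case: (_ == 1%N) => /=; lra.
- pose h k : R := (k == n./2)%:R + (k == 1%N)%:R / 2.
  rewrite (@star_sum_sides_diameter _ h) => [|k /negPf k1 /negPf kd].
    by rewrite /h !eqxx half_neq1 (eq_sym 1%N) half_neq1 /=; lra.
  by rewrite /h k1 kd /=; lra.
exact: half_cycle_point_cut.
Qed.

(** * Costs of the circlet inequality *)

Notation f := (circlet_f R n).
Notation d := (n./2).

Lemma circlet_f_half : f d = d%:R - 2.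
Proof. by rewrite /circlet_f ifF; [lra | lia]. Qed.

Lemma circlet_f1 : f 1 = d%:R - 1.
Proof. by rewrite /circlet_f /=; lra. Qed.

Lemma circlet_f_pred_half : f d.-1 = 2 * d%:R - 3.
Proof.
rewrite /circlet_f ifT; last lia.
have : d.-1.+1%:R = d%:R :> R by congr _%:R; lia.
rewrite -addn1 natrD; lra.
Qed.

(** The indicator of the length [d] absorbs the discount on diameters. For even
    [k] other than [d], parity of [d] forces [k + 2 <= d]. *)
Lemma circlet_f_ge k : (0 < k <= d)%N -> d%:R - 1 <= f k + (k == d)%:R.
Proof.
move=> /andP[k0 kd]; have : 1 <= k%:R :> R by rewrite (ler_nat _ 1).
have [->|kNd] := eqVneq k d; first by rewrite circlet_f_half /=; lra.
rewrite /circlet_f /= addr0; case: ifP => ok; first lra.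
have : (k + 2)%:R <= d%:R :> R by rewrite ler_nat; lia.
rewrite natrD; lra.
Qed.

(** As [d] is even, an odd [k] is at most [d - 1]. *)
Lemma circlet_f_le k : (0 < k <= d)%N -> f k <= 2 * d%:R - 3.
Proof.
move=> /andP[k0 kd]; rewrite /circlet_f; case: ifP => ok.
  have : (k + 1)%:R <= d%:R :> R by rewrite ler_nat; lia.
  rewrite natrD; lra.
have : 2 <= k%:R :> R by rewrite ler_nat; lia.
lra.
Qed.

(** Two sides of a triangle cannot both be diameters, so they cost together at
    least the maximal cost [2 d - 3]. *)
Lemma circlet_tight_triangular : tight_triangular (circlet_coef R n).
Proof.
split=> [i j k ij jk ik | j]; rewrite /circlet_coef.
  rewrite !edge_lenE.
  have := circlet_f_ge (circ_dist_bounds ij).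
  have := circlet_f_ge (circ_dist_bounds jk).
  have := circlet_f_le (circ_dist_bounds ik).
  rewrite circ_dist_half.
  have [kj|_] := eqVneq k (rot d j).
    have -> : (circ_dist i j == d) = false.
      rewrite circ_dist_half; apply/negP => /eqP ji.
      by move: ik; rewrite kj ji rot_halfK eqxx.
    by move=> /=; lra.
  by case: (circ_dist i j == d) => /=; lra.
have ij : rot d j != j by rewrite eq_sym diameter_proof.
have ik : rot d j != rot 1 j by rewrite rot_eq; lia.
exists (rot d j), (rot 1 j), ij, (side_proof j), ik; rewrite !edge_lenE.
have /eqP-> : circ_dist (rot d j) j == d.
  by rewrite circ_dist_half rot_halfK.
have /eqP-> : circ_dist j (rot 1 j) == 1%N by rewrite circ_dist1 eqxx.
have -> : circ_dist (rot d j) (rot 1 j) = d.-1.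
  have jn := ltn_ord j; rewrite /circ_dist !rotE; try lia.
  by do 2!case: ltnP => ?; lia.
rewrite circlet_f_half circlet_f1 circlet_f_pred_half; lra.
Qed.

Lemma dot_circletE (x : edge n -> R) :
  dot (circlet_coef R n) x = \sum_(1 <= i < d.+1) f i * len_sum i x.
Proof.
under eq_bigr => i _ do rewrite mulr_sumr.
rewrite (exchange_big_dep predT) //=; apply: eq_bigr => e _.
rewrite big_mkcond (bigD1_seq (edge_len e)) ?iota_uniq //=; last first.
  by rewrite mem_index_iota ltnS edge_len_bounds.
rewrite eqxx big1 ?addr0 // => i ie; case: eqVneq => // ei.
by rewrite ei eqxx in ie.
Qed.

(** The bound holds at each vertex: degree [2] at unit cost [d - 1], minus at
    most [1] saved on the unique diameter. *)
Lemma circlet_lower_bound (x : edge n -> R) : subtour_polytope x ->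
  d%:R * (2 * d%:R - 3) <= dot (circlet_coef R n) x.
Proof.
case=> deg _ x01.
have star v : 2 * d%:R - 3 <=
    \sum_(e in cut [set v]) circlet_coef R n e * x e.
  have diam : \sum_(e in cut [set v]) (edge_len e == d)%:R = 1 :> R.
    rewrite (@star_sum_sides_diameter _ (fun k => (k == d)%:R)).
      by rewrite eqxx eq_sym half_neq1 /=; lra.
    by move=> k _ /negPf->.
  have -> : 2 * d%:R - 3 = \sum_(e in cut [set v])
      ((d%:R - 1) * x e - (edge_len e == d)%:R) :> R.
    rewrite sumrB -mulr_sumr deg diam; lra.
  apply: ler_sum => e _.
  have /andP[xe0 xe1] := x01 e.
  have := circlet_f_ge (edge_len_bounds e); rewrite /circlet_coef.
  by case: (_ == d) => /= fe; nra.
have : \sum_(v : 'I_n) (2 * d%:R - 3) <= 2 * dot (circlet_coef R n) x.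
  by rewrite -handshake; apply: ler_sum.
rewrite sumr_const card_ord -[_ *+ n]mulr_natl.
have -> : n%:R = 2 * d%:R :> R by rewrite -natrM; congr _%:R; lia.
lra.
Qed.

(** At each vertex, the diameter costs [d - 2] and the two half sides [d - 1]. *)
Lemma circlet_half_cycle_point :
  dot (circlet_coef R n) half_cycle_point = d%:R * (2 * d%:R - 3).
Proof.
have : 2 * dot (circlet_coef R n) half_cycle_point =
    \sum_(v : 'I_n) (2 * d%:R - 3).
  rewrite -handshake; apply: eq_bigr => v _.
  pose h k : R := f k * ((k == d)%:R + (k == 1%N)%:R / 2).
  rewrite (@star_sum_sides_diameter _ h) => [|k /negPf k1 /negPf kd].
    rewrite /h !eqxx half_neq1 (eq_sym 1%N) half_neq1 /=.
    by rewrite circlet_f_half circlet_f1; lra.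
  by rewrite /h k1 kd /=; lra.
rewrite sumr_const card_ord -[_ *+ n]mulr_natl.
have -> : n%:R = 2 * d%:R :> R by rewrite -natrM; congr _%:R; lia.
lra.
Qed.

Lemma circlet_is_min : is_min_subtour (circlet_coef R n) (d%:R * (2 * d%:R - 3)).
Proof.
split; last exact: circlet_lower_bound.
by exists half_cycle_point;
  [exact: half_cycle_point_subtour | exact: circlet_half_cycle_point].
Qed.

End Optimum.
End Circle.

Theorem theorem6p2 (R : realType) (n : nat) (n_gt0 : (0 < n)%N)
    (n_div4 : (4 %| n)%N) :
  let strength : R :=
    (n%:R ^+ 2 - 2 * n%:R - 4) / (n%:R ^+ 2 - 3 * n%:R) in
  [/\ forall x : edge n -> R,
        dot (circlet_coef R n) x =
        \sum_(1 <= i < n./2.+1) circlet_f R n i * len_sum i x,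
      tight_triangular (circlet_coef R n),
      has_strength (circlet_coef R n) (circlet_rhs R n) strength,
      strength <= 11 / 10
    & n = 8%N -> strength = 11 / 10].
Proof.
move=> strength.
have nE : n%:R = 2 * n./2%:R :> R by rewrite -natrM; congr _%:R; lia.
have n4 : 4 <= n%:R :> R by rewrite ler_nat; lia.
have m_gt0 : 0 < n%:R ^+ 2 - 3 * n%:R :> R by nra.
split.
- exact: dot_circletE.
- exact: circlet_tight_triangular.
- exists (n./2%:R * (2 * n./2%:R - 3)); split; first exact: circlet_is_min.
    by apply: lt0r_neq0; nra.
  rewrite /strength /circlet_rhs nE; field.
  by rewrite -nE !lt0r_neq0 //; lra.
- rewrite /strength ler_pdivrMr //.
  have : n = 4%N \/ (8 <= n)%N by lia.
  case=> [-> | n8]; first lra.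
  have : 8 <= n%:R :> R by rewrite ler_nat.
  (* The difference of the two sides is a multiple of (n - 5) (n - 8). *)
  nra.
by move=> n8; rewrite /strength n8; field.
Qed.
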